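(* Let $G$ be a finite Camina $p$-group of nilpotency class $3$. Then $$\zeta^{w_3}_G=|G|^2\sum_{\chi\in\mathrm{lin}(G)}\chi+\left(\frac{|G|^3}{|G'|}+\frac{|G|^2(|G'|-|Z(G)|)}{|Z(G)|}\right)\sum_{\chi\in\mathrm{Irr}(G|Z(G))}\frac{\chi}{\chi(1)}+\frac{|G|^3}{|G'|}\sum_{\chi\in\mathrm{nl}(G/Z(G))}\frac{\chi}{\chi(1)}.$$
   Context: $[a,b]=a^{-1}b^{-1}ab$, $w_3(x_1,x_2,x_3)=[[x_1,x_2],x_3]$, and $\zeta^{w_3}_G(g)=|\{(a_1,a_2,a_3)\in G^3: w_3(a_1,a_2,a_3)=g\}|$. $Z(G)$ is the center and $G'=[G,G]$. A pair $(G,H)$ is a Camina pair if $1<H<G$ is a normal subgroup of $G$ and $gH\subseteq \mathrm{Cl}_G(g)$ (the conjugacy class of $g$) for every $g\in G\setminus H$; $G$ is a Camina group if $(G,G')$ is a Camina pair, and a Camina $p$-group is a Camina group that is a $p$-group ($p$ prime). $\mathrm{Irr}(G)$, $\mathrm{lin}(G)$, $\mathrm{nl}(G)$ are the sets of all irreducible, linear, and nonlinear irreducible complex characters of $G$. For $N$ normal in $G$, characters of $G/N$ are identified with their inflations to $G$, and $\mathrm{Irr}(G|N)=\mathrm{Irr}(G)\setminus\mathrm{Irr}(G/N)$. *)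

(* Defs.v *)
From mathcomp Require Import all_boot all_order all_algebra.
From mathcomp Require Import all_fingroup all_solvable all_field all_character.

Set Implicit Arguments.
Unset Strict Implicit.
Unset Printing Implicit Defensive.

Import GroupScope.

(* [~ x, y] is x^-1 * x ^ y = x^-1 * y^-1 * x * y. *)
Definition w3 (gT : finGroupType) (x1 x2 x3 : gT) : gT := [~ [~ x1, x2], x3].

Definition zeta_w3 (gT : finGroupType) (G : {set gT}) (g : gT) : nat :=
  #|[set a : gT * gT * gT |
      [&& a.1.1 \in G, a.1.2 \in G, a.2 \in G & w3 a.1.1 a.1.2 a.2 == g]]|.

Definition camina_pair (gT : finGroupType) (G H : {set gT}) : bool :=
  [&& [1 gT] \proper H, H \proper G, H <| G
    & [forall g in G :\: H, g *: H \subset g ^: G]].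

Definition camina_group (gT : finGroupType) (G : {set gT}) : bool :=
  camina_pair G G^`(1).

(* Sets of irreducible characters are represented by sets of indices. *)
Definition lin_Iirr (gT : finGroupType) (G : {group gT}) : {set Iirr G} :=
  [set i : Iirr G | ('chi_i)%R \is a linear_char].

Definition nl_Iirr (gT : finGroupType) (G : {group gT}) : {set Iirr G} :=
  ~: lin_Iirr G.

(* Irr(G | N): mod_Iirr sends the index of a character of G / N to that of its
   inflation to G (for N normal in G). *)
Definition Iirr_over (gT : finGroupType) (G N : {group gT}) : {set Iirr G} :=
  [set: Iirr G] :\: [set mod_Iirr j | j : Iirr (G / N)].

(* Main.v *)
Require Import Defs.
From mathcomp Require Import all_boot all_order all_algebra.
From mathcomp Require Import all_fingroup all_solvable all_field all_character.
From mathcomp Require Import ring.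

Set Implicit Arguments.
Unset Strict Implicit.
Unset Printing Implicit Defensive.

Import GroupScope GRing.Theory.
Local Open Scope ring_scope.

(* Write L = [G', G] and Z = Z(G).  The crux is that Z = L and that every
   element y of G' outside L has conjugacy class y L.  Dividing out a maximal
   proper subgroup of L that contains [y, G], this reduces to proving Z = L when
   |L| = p.  In that case put C = C_G(G'):
   - the commutator pairing G'/Z x G/C -> L is nondegenerate, so
     |G' : Z| = |G : C|;
   - [C, C] <= Z by the three subgroup lemma, so C/M is abelian for any
     hyperplane M >= Z of G', and as G/M has center G'/M of order p this gives
     |C|^2 <= |G| |G'|;
   - in the class 2 Camina group G/L, |G' : L|^2 <= |G : G'|.
   Together these force |Z| <= |L|.  The last inequality is a Chevalley-Warning
   argument: each nonzero linear form on G'/L turns the commutator into a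
   nondegenerate alternating form on G/G', so the Pfaffian, of degree
   (dim G/G') / 2 in the form, has no nontrivial zero.

   Characters of G nontrivial on Z vanish off Z and have degree |G : Z|^(1/2),
   and likewise for G/Z and G'/Z, so the right-hand side is computed from regular
   characters; the left-hand side is counted directly, a -> [y, a] having all its
   nonempty fibers of size |C_G(y)|. *)

(** * Alternating forms over a finite field *)

(** Scaling t by [a] multiplies the sum by a^n, and for 0 < n < q - 1 some nonzero [a] has a^n
    different from 1, as X^n - 1 has at most n roots. For n = 0, replacing t by t + 1 in the sum of
    all t shows that |F| is 0 in F. *)
Lemma sum_expf_finField (F : finFieldType) n :
  (n < #|F|.-1)%N -> \sum_(t : F) t ^+ n = 0.
Proof.
case: n => [_|n n_lt].
  apply: (addrI (\sum_(t : F) t)); rewrite addr0 -big_split /=.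
  under eq_bigr do rewrite expr0.
  rewrite [RHS](reindex (+%R^~ 1)) //=.
  by exists (+%R^~ (-1)) => t _ /=; rewrite ?addrK ?subrK.
have [a an1 a0]: exists2 a : F, a ^+ n.+1 != 1 & a != 0.
  apply/exists_inP; apply/contraLR: n_lt => /exists_inPn an1.
  rewrite -leqNgt -(cardC1 0) cardE.
  apply: (@max_unity_roots F) => //; last exact: enum_uniq.
  apply/allP=> x; rewrite mem_enum inE => x0; apply/unity_rootP.
  by apply/eqP/contraT => /an1; rewrite x0.
have: a ^+ n.+1 * \sum_(t : F) t ^+ n.+1 = \sum_(t : F) t ^+ n.+1.
  rewrite big_distrr [RHS](reindex ( *%R a)) /=.
    by apply: eq_bigr => t _; rewrite exprMn.
  by exists ( *%R a^-1) => t _ /=; rewrite mulrA ?mulVf ?divff ?mul1r.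
move/eqP; rewrite -subr_eq0 -{2}[\sum_(t : F) _]mul1r -mulrBl mulf_eq0.
by rewrite subr_eq0 (negbTE an1) => /eqP.
Qed.

(* A monomial in w variables of degree < w (q - 1) has some exponent < q - 1,
   and its sum over that variable vanishes. *)
Lemma sum_prod_linear_forms (F : finFieldType) (I : finType) w
    (l : I -> 'I_w -> F) :
  (#|I| < w * #|F|.-1)%N ->
  \sum_(x : {ffun 'I_w -> F}) \prod_i \sum_k l i k * x k = 0.
Proof.
move=> ltI; under eq_bigr do rewrite bigA_distr_bigA.
rewrite exchange_big big1 //= => f _.
under eq_bigr do rewrite big_split /=.
rewrite -big_distrr /=.
(* [f] picks a variable from every factor, so the exponent of x_k in its monomial is the size of the
   fiber of [f] over k. *)
under [X in _ * X]eq_bigr => x _.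
  rewrite (partition_big f xpredT) //=.
  under eq_bigr => k _.
    rewrite (eq_bigr (fun=> x k)); last by move=> i /eqP->.
    rewrite prodr_const; over.
  over.
rewrite -(bigA_distr_bigA (fun k t => t ^+ #|(fun i => f i == k)|)).
suff [k lt_k]: exists k, (#|(fun i => f i == k)| < #|F|.-1)%N.
  by rewrite (bigD1 k) //= sum_expf_finField ?mul0r ?mulr0.
apply/existsP; apply: contraLR ltI => /existsPn ge_k.
rewrite -leqNgt -(sum1_card I) (partition_big f xpredT) //=.
rewrite -{1}(card_ord w) -sum_nat_const; apply: leq_sum => k _.
by rewrite sum1_card leqNgt ge_k.
Qed.

Lemma sum_prod_linear_forms_in (F : finFieldType) (I : finType) (P : {pred I}) w
    (l : I -> 'I_w -> F) :
  (#|P| < w * #|F|.-1)%N ->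
  \sum_(x : {ffun 'I_w -> F}) \prod_(i in P) \sum_k l i k * x k = 0.
Proof.
move=> ltP.
under eq_bigr do rewrite big_enum_val.
by apply: (sum_prod_linear_forms (fun i : 'I_#|P| => l (enum_val i)));
  rewrite card_ord.
Qed.

(** Induction in steps of two: permuting rows and columns alike makes the leading 2 x 2 block [J]
    invertible, with square determinant, and the Schur complement of [J] is again antisymmetric. *)
Lemma det_antisym_square (F : fieldType) n (A : 'M[F]_n) :
  2 \notin [pchar F] -> A^T = - A -> exists d, \det A = d ^+ 2.
Proof.
move=> char2; have antiE m (M : 'M[F]_m) : M^T = - M ->
    (forall i k, M i k = - M k i) /\ (forall i, M i i = 0).
  move=> MT; have ME i k : M i k = - M k i.
    by have /matrixP/(_ k i) := MT; rewrite !mxE.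
  split=> // i; apply/eqP; have /eqP := ME i i; rewrite -subr_eq0 opprK.
  rewrite -mulr2n -mulr_natr mulf_eq0; case/orP=> // z2; case/negP: char2.
  by rewrite inE.
elim/ltn_ind: n A => -[|[|n]] IHn A AT.
- by exists 1; rewrite det_mx00 expr1n.
- by exists 0; rewrite det_mx11 (antiE _ _ AT).2 expr0n.
have [AE A0] := antiE _ _ AT.
have [j A0j | A0j] := pickP (fun j => A 0 j != 0); last first.
  exists 0; rewrite expr0n (expand_det_row _ 0) big1 // => j _.
  by move/negbFE/eqP: (A0j j) => ->; rewrite mul0r.
have j0: j != 0 by apply: contraNneq A0j => ->; rewrite A0.
pose s := tperm 1 j.
pose B : 'M_(2 + n) := row_perm s (col_perm s A).
have ->: \det A = \det B.
  rewrite /B row_permE col_permE !det_mulmx !det_perm odd_permV.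
  by rewrite mulrCA -signr_addb addbb mulr1.
have BT: B^T = - B by apply/matrixP => i k; rewrite !mxE AE.
have B01: B 0 1 != 0 by rewrite !mxE tpermL tpermD // eq_sym.
clearbody B; clear s A AT AE A0 j A0j j0; have [BE B0] := antiE _ _ BT.
pose J := ulsubmx B; pose U := ursubmx B; pose D := drsubmx B.
have JT : J^T = - J by apply/matrixP => i k; rewrite !mxE BE.
have UT : dlsubmx B = - U^T by apply/matrixP => i k; rewrite !mxE BE.
have DT : D^T = - D by apply/matrixP => i k; rewrite !mxE BE.
have detJ : \det J = (B 0 1) ^+ 2.
  rewrite (expand_det_row _ 0) !big_ord_recl big_ord0 /cofactor !det_mx11.
  rewrite !mxE /= B0 mul0r add0r addr0 expr1 mulN1r.
  rewrite [X in - X]BE opprK expr2.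
  by congr (B _ _ * B _ _); apply: val_inj.
have uJ : J \in unitmx by rewrite unitmxE detJ unitfE expf_neq0.
(* The Schur complement of [J]; the plus sign comes from the lower left block being -U^T. *)
have [|d detD] := IHn n (leqnSn _) (D + U^T *m invmx J *m U).
  rewrite linearD /= DT !trmx_mul trmxK trmx_inv JT opprD; congr (_ + _).
  rewrite -(scaleN1r J) invmxZ ?invrN1 ?scaleN1r ?mulNmx ?mulmxN ?mulmxA //.
  by rewrite -JT unitmx_tr.
exists (B 0 1 * d).
rewrite exprMn -detJ -detD -(det_ublock J U).
have <-: block_mx 1%:M 0 (U^T *m invmx J) 1%:M *m B
         = block_mx J U 0 (D + U^T *m invmx J *m U).
  rewrite -[B in LHS]submxK mulmx_block UT !mul1mx !mul0mx !addr0.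
  by rewrite -/J -/U -/D mulmxKV // subrr addrC.
by rewrite det_mulmx det_lblock !det1 !mul1r.
Qed.

(* In characteristic 2 signs are immaterial and the terms of s and s^-1 in the
   Leibniz formula coincide, so that only the involutions without fixed points
   contribute; their terms are squares. *)
Lemma det_alternating_char2 (F : fieldType) n (A : 'M[F]_n) :
  2 \in [pchar F] -> A^T = A -> (forall i, A i i = 0) ->
  \det A = (\sum_(s : 'S_n | (s^-1 == s)%g && [forall i, s i != i])
              \prod_(i : 'I_n | (i < s i)%N) A i (s i)) ^+ 2.
Proof.
move=> char2 AT A0.
have AE i k : A i k = A k i by have /matrixP/(_ k i) := AT; rewrite !mxE.
have -> : \det A = \sum_(s : 'S_n) \prod_i A i (s i).
  by apply: eq_bigr => s _; rewrite oppr_pchar2 // expr1n mul1r.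
pose T (s : 'S_n) := \prod_i A i (s i).
have TV s : T s^-1%g = T s.
  rewrite /T [RHS](reindex_inj (@perm_inj _ s^-1%g)) /=.
  by apply: eq_bigr => i _; rewrite permKV AE.
rewrite (bigID (fun s : 'S_n => (s^-1 == s)%g)) /=.
rewrite [X in _ + X](_ : _ = 0); last first.
  (* [lo] selects one permutation from each pair {s, s^-1} of distinct inverses. *)
  pose lo (s : 'S_n) := (enum_rank s < enum_rank s^-1%g)%N.
  rewrite (bigID lo) /= [X in _ + X](reindex_inj invg_inj) /=.
  rewrite [X in _ + X](eq_big (fun s => (s^-1 != s)%g && lo s) T) //; last first.
    by move=> s _; exact: TV.
    move=> s; rewrite invgK /lo eq_sym -leqNgt leq_eqVlt invgK.
    by case: eqVneq => //= ne_s;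
      rewrite (inj_eq val_inj) (inj_eq enum_rank_inj) eq_sym (negbTE ne_s).
  by rewrite addrr_pchar2.
rewrite addr0 (bigID (fun s : 'S_n => [forall i, s i != i])) /=.
rewrite [X in _ + X]big1 ?addr0 => [|s /andP[_ /forallPn[i]]]; last first.
  by rewrite negbK => /eqP si; rewrite (bigD1 i) //= si A0 mul0r.
rewrite -(pFrobenius_autE char2) rmorph_sum; apply: eq_bigr => s.
case/andP=> /eqP sV /forallP fpf; rewrite /= pFrobenius_autE expr2.
rewrite (bigID (fun i : 'I_n => i < s i)%N) /=; congr (_ * _).
have sK i : s (s i) = i by rewrite -{1}sV permK.
rewrite (reindex_inj (@perm_inj _ s)) /=; apply: eq_big => i; last first.
  by rewrite sK AE.
by rewrite sK -leqNgt leq_eqVlt eq_sym (inj_eq val_inj) (negbTE (fpf i)).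
Qed.

(* For odd p the power (p - 1) / 2 of det (A x), and for p = 2 its square root,
   is a polynomial of degree v (p - 1) / 2 in x whose value is 1 if A x is
   invertible, since det (A x) is then a nonzero square, and 0 otherwise. *)
Lemma alternating_family_bound p v w (a : 'I_v -> 'I_v -> 'I_w -> 'F_p)
    (A := fun x : {ffun 'I_w -> 'F_p} => \matrix_(i, j) \sum_k a i j k * x k) :
  prime p -> (0 < v)%N ->
  (forall i j k, a i j k = - a j i k) -> (forall i k, a i i k = 0) ->
  (forall x, x != 0 -> A x \in unitmx) -> (w.*2 <= v)%N.
Proof.
move=> p_pr v_gt0 aE a0 uA; rewrite leqNgt; apply/negP => lt_vw.
have w_gt0 : (0 < w)%N by case: w {a A aE a0 uA} lt_vw.
have oF : #|'F_p|.-1 = p.-1 by rewrite card_Fp.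
have AT x : (A x)^T = - A x.
  apply/matrixP => i j; rewrite !mxE -sumrN; apply: eq_bigr => k _.
  by rewrite aE mulNr.
have A0 x i : A x i i = 0 by rewrite mxE big1 // => k _; rewrite a0 mul0r.
(* [N] counts the invertible [A x] modulo p. Only x = 0 fails, where the determinant is 0 because v
   > 0, so N = p^w - 1 = -1; the degree bound will give N = 0. *)
pose N := \sum_x (\det (A x) != 0)%:R : 'F_p.
have N_neq0 : N != 0.
  have -> : N = - 1.
    have detA0 : \det (A 0) = 0.
      have -> : A 0 = 0.
        by apply/matrixP => i j; rewrite !mxE big1 // => k _; rewrite ffunE mulr0.
      by case: v v_gt0 {a A aE a0 uA lt_vw AT A0 N} => // v _; rewrite det0.
    rewrite /N (bigD1 (0 : {ffun 'I_w -> 'F_p})) //= detA0 eqxx add0r.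
    rewrite (eq_bigr (fun=> 1)) => [|x x0]; last first.
      by have := uA x x0; rewrite unitmxE unitfE => ->.
    rewrite sumr_const cardC1 card_ffun card_Fp // card_ord.
    apply/eqP; rewrite -subr_eq0 opprK -mulrSr prednK ?expn_gt0 ?prime_gt0 //.
    by rewrite natrX pchar_Fp_0 // expr0n eqn0Ngt w_gt0.
  by rewrite oppr_eq0 oner_eq0.
case/eqP: N_neq0.
have [p2 | p_odd] := even_prime p_pr.
- have char2 : 2 \in [pchar 'F_p] by rewrite -[X in X \in _]p2 pchar_Fp.
  have sqrF (t : 'F_p) : t ^+ 2 = t.
    by rewrite -[X in _ ^+ X]p2 -[in RHS](expf_card t) card_Fp.
  have -> : N = \sum_(x : {ffun 'I_w -> 'F_p})
                \sum_(s : 'S_v | (s^-1 == s)%g && [forall i, s i != i])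
                  \prod_(i in [pred i : 'I_v | i < s i]%N) \sum_k a i (s i) k * x k.
    apply: eq_bigr => x _; rewrite det_alternating_char2 // ?sqrF; last first.
      by rewrite AT; apply/matrixP => i j; rewrite mxE oppr_pchar2.
    rewrite (_ : _%:R = \sum_(s : 'S_v | (s^-1 == s)%g && [forall i, s i != i])
              \prod_(i : 'I_v | (i < s i)%N) A x i (s i)).
      by apply: eq_bigr => s _; apply: eq_bigr => i _; rewrite mxE.
    by case: eqVneq => [-> // | nz]; apply: (mulIf nz); rewrite mul1r -expr2 sqrF.
  rewrite exchange_big big1 //= => s /andP[/eqP sV /forallP fpf].
  apply: (sum_prod_linear_forms_in (fun i => a i (s i))).
  (* The i with i < s i and their images under [s] form disjoint sets, so there are at most v / 2 <
     w factors. *)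
  rewrite oF p2 muln1 -ltn_double; apply: leq_ltn_trans lt_vw.
  have sK i : s (s i) = i by rewrite -{1}sV permK.
  apply: (@leq_trans #|'I_v|); last by rewrite card_ord.
  rewrite -addnn -{1}(card_image (@perm_inj _ s)) -cardUI.
  by rewrite [X in (_ + X)%N]eq_card0 ?addn0 ?max_card // => i; rewrite !inE;
     apply/negP => /andP[/imageP[j]]; rewrite inE => lt_j ->; rewrite sK ltnNge ltnW.
have half_p : (p.-1./2.*2 = p.-1)%N.
  by rewrite -[RHS]odd_double_half -subn1 oddB ?prime_gt0 // p_odd.
(* With h = (p - 1) / 2, expanding the h-th power of the determinant chooses h permutations; each
   term is a product of h v < w (p - 1) linear forms. *)
have -> : N = \sum_(x : {ffun 'I_w -> 'F_p}) \sum_(f : {ffun 'I_p.-1./2 -> 'S_v})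
     (\prod_h (-1) ^+ (f h)) *
     \prod_(z : 'I_p.-1./2 * 'I_v) \sum_k a z.2 (f z.1 z.2) k * x k.
  apply: eq_bigr => x _.
  transitivity (\det (A x) ^+ p.-1./2).
    case: eqVneq => [-> | nz].
      rewrite expr0n; case: eqP => // h0.
      by have := prime_gt1 p_pr; rewrite -subn_gt0 subn1 -half_p h0.
    have [|d Dd] := det_antisym_square _ (AT x).
      by rewrite (pcharf_eq (pchar_Fp p_pr)) inE; apply: contraTneq p_odd => <-.
    rewrite Dd -exprM mul2n half_p.
    have d0 : d != 0 by apply: contraNneq nz => d0; rewrite Dd d0 expr0n.
    by apply: (mulIf d0); rewrite mul1r -exprSr prednK ?prime_gt0 //
      -[X in _ ^+ X](card_Fp p_pr) expf_card.
  rewrite -[in LHS](card_ord p.-1./2) -prodr_const bigA_distr_bigA /=.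
  apply: eq_bigr => f _; rewrite big_split /=; congr (_ * _).
  rewrite (pair_bigA _ (fun h i => A x i (f h i))) /=.
  by apply: eq_bigr => z _; rewrite mxE.
rewrite exchange_big big1 //= => f _; rewrite -big_distrr /=.
pose l (z : 'I_p.-1./2 * 'I_v) := a z.2 (f z.1 z.2).
rewrite (sum_prod_linear_forms l) ?mulr0 //.
rewrite oF card_prod !card_ord -[ltnRHS](congr1 (muln w) half_p).
rewrite -muln2 mulnCA mulnC muln2 mulnC ltn_pmul2l //.
by have := prime_gt1 p_pr; rewrite -subn_gt0 subn1 -half_p; case: _./2.
Qed.

(** Scalars of a prime field are multiples of 1, so additive maps are linear. *)
Lemma Fp_additive_mx p v w (f : 'rV['F_p]_v -> 'rV['F_p]_w) u :
  {morph f : x y / x + y} -> f u = \sum_i u 0 i *: f (delta_mx 0 i).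
Proof.
move=> fD; have f0 : f 0 = 0 by apply: (addrI (f 0)); rewrite -fD !addr0.
have fMn x n : f (x *+ n) = f x *+ n by elim: n => // n IHn; rewrite !mulrS fD IHn.
rewrite {1}(row_sum_delta u) (big_morph f fD f0); apply: eq_bigr => i _.
by rewrite -[u 0 i]natr_Zp !scaler_nat fMn.
Qed.

(** Composing [B] with the linear form of coefficients [l] gives an alternating form whose matrix is
    linear in [l]. If a nonzero u lies in its radical, [l] vanishes on all values [B u y], hence l =
    0 by surjectivity. *)
Lemma alternating_map_bound p v w (B : 'rV['F_p]_v -> 'rV['F_p]_v -> 'rV['F_p]_w) :
  prime p -> (0 < v)%N ->
  (forall z, {morph B^~ z : x y / x + y}) ->
  (forall z, {morph B z : x y / x + y}) -> (forall x, B x x = 0) ->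
  (forall x z, x != 0 -> exists y, B x y = z) -> (w.*2 <= v)%N.
Proof.
move=> p_pr v_gt0 BDl BDr Balt Bsurj.
pose e i : 'rV['F_p]_v := delta_mx 0 i.
apply: (@alternating_family_bound p v w (fun i j k => B (e i) (e j) 0 k)) => //.
- move=> i j k; have := Balt (e i + e j); rewrite BDl !BDr !Balt add0r addr0.
  by move/rowP/(_ k); rewrite !mxE => /eqP; rewrite addr_eq0 => /eqP.
- by move=> i k; rewrite Balt mxE.
move=> l; apply: contraR; rewrite unitmxE unitfE negbK => /det0P[u u0 uA].
apply/eqP/ffunP => k; rewrite ffunE.
have BE y : \sum_k B u y 0 k * l k = 0.
  rewrite (Fp_additive_mx y (BDr u)).
  under eq_bigr => h _ do rewrite summxE big_distrl /=.
  rewrite exchange_big big1 //= => j _.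
  under eq_bigr => h _ do rewrite mxE -mulrA.
  rewrite -big_distrr /= (Fp_additive_mx u (BDl _)).
  have /rowP/(_ j) := uA; rewrite !mxE => uAj.
  suff -> : \sum_h (\sum_i u 0 i *: B (e i) (e j)) 0 h * l h = 0 by rewrite mulr0.
  rewrite -[RHS]uAj; under eq_bigr => h _ do rewrite summxE big_distrl /=.
  rewrite exchange_big; apply: eq_bigr => i _ /=.
  by rewrite mxE big_distrr; apply: eq_bigr => h _ /=; rewrite mxE mulrA.
have [y Dy] := Bsurj u (delta_mx 0 k) u0.
have := BE y; rewrite Dy (bigD1 k) //= big1 => [|h hk].
  by rewrite mxE !eqxx mul1r addr0.
by rewrite mxE eqxx (negbTE hk) mul0r.
Qed.

(** * Camina groups *)

Local Open Scope group_scope.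

(** * Commutator maps and pairings *)

Lemma card_commutator_fiber (gT : finGroupType) (G K : {group gT}) y g :
  y \in G -> y ^: G = y *: K ->
  (#|[set a in G | [~ y, a] == g]| * #|K| = (g \in K) * #|G|)%N.
Proof.
move=> Gy clE.
have oK : #|G : 'C_G[y]| = #|K| by rewrite index_cent1 clE card_lcoset.
have memE a : ([~ y, a] == g) = (y ^ a == y * g).
  by rewrite commgEl -(inj_eq (mulgI y)) mulKVg.
case: (boolP (g \in K)) => [Kg | notKg]; last first.
  rewrite mul0n; apply/eqP; rewrite muln_eq0 cards_eq0; apply/orP; left.
  apply: contraR notKg => /set0Pn[a]; rewrite inE memE => /andP[Ga /eqP ya].
  have : y ^ a \in y *: K by rewrite -clE memJ_class.
  by rewrite ya mem_lcoset mulKg.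
have [b Gb yb] : exists2 b, b \in G & y ^ b = y * g.
  have : y * g \in y ^: G by rewrite clE mem_lcoset mulKg.
  by case/imsetP=> b Gb ->; exists b.
have -> : [set a in G | [~ y, a] == g] = 'C_G[y] :* b.
  apply/setP => a; rewrite inE memE mem_rcoset in_setI groupMr ?groupV //.
  rewrite -yb; congr (_ && _); apply/eqP/idP=> [yab | /cent1P].
    apply/cent1P; apply: commute_sym; apply/commgP/conjg_fixP.
    by rewrite conjgM yab conjgK.
  move=> /(@commute_sym _ _ _)/commgP/conjg_fixP fix_y.
  by rewrite -{2}fix_y -conjgM mulgKV.
by rewrite card_rcoset -oK Lagrange ?subsetIl // mul1n.
Qed.

(** As [P] centralizes [B], [a, bc] = [a, c] [a, b]^c = [a, c] [a, b], so b -> [a, b] is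
    multiplicative on [B]. *)
Lemma commutator_image_group (gT : finGroupType) (B P : {group gT}) a :
  abelian P -> P \subset 'C(B) -> {in B, forall b, [~ a, b] \in P} ->
  group_set [set [~ a, b] | b in B].
Proof.
move=> abP cPB aBP; apply/group_setP; split.
  by apply/imsetP; exists 1; rewrite ?group1 ?comm1g ?commg1.
move=> _ _ /imsetP[b Bb ->] /imsetP[c Bc ->]; apply/imsetP.
exists (b * c); rewrite ?groupM // commgMJ.
have /commgP/conjg_fixP-> := centsP cPB _ (aBP b Bb) _ Bc.
by rewrite (centsP abP) ?aBP.
Qed.

Lemma card_commutator_image (gT : finGroupType) (B : {group gT}) a :
  #|[set [~ a, b] | b in B]| = #|B : 'C_B[a]|.
Proof.
rewrite index_cent1 -(card_lcoset (a ^: B) a^-1); apply: eq_card => z.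
rewrite mem_lcoset invgK; apply/imsetP/imsetP=> [] [b Bb Dz]; exists b => //.
  by rewrite Dz commgEl mulKVg.
by rewrite commgEl -Dz mulKg.
Qed.

(** Commuting pairs are counted in two ways: for a in [A] outside ['C(B)], [a, B] is a nontrivial
    subgroup of [P], hence equals [P], and |C_B(a)| = |B| / |P|. *)
Lemma card_cent_commutator_prime (gT : finGroupType) (A B P : {group gT}) :
  prime #|P| -> P \subset 'C(A) -> P \subset 'C(B) -> [~: A, B] \subset P ->
  (#|A| * #|'C_B(A)| = #|B| * #|'C_A(B)|)%N.
Proof.
move=> p_pr cPA cPB sABP.
have abP : abelian P by rewrite cyclic_abelian ?prime_cyclic.
pose N (A B : {group gT}) := (\sum_(a in A) #|'C_B[a]|)%N.
(* With c = |C_A1(B1)| this is N = c |B1| + (|A1| - c) |B1| / |P|, freed of subtraction and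
   division. *)
have count (A1 B1 : {group gT}) : P \subset 'C(B1) -> [~: A1, B1] \subset P ->
    (#|P| * N A1 B1 + #|'C_A1(B1)| * #|B1|
     = #|P| * (#|'C_A1(B1)| * #|B1|) + #|A1| * #|B1|)%N.
  move=> cPB1 sABP1.
  have oC : #|'C_A1(B1)| = (\sum_(a in A1) (a \in 'C(B1)))%N.
    by rewrite -sum1_card (eq_bigl _ _ (fun x => in_setI x _ _)) big_mkcondr.
  rewrite /N oC -[#|A1|]sum1_card !big_distrl !big_distrr -!big_split /=.
  apply: eq_bigr => a Aa; rewrite mul1n.
  have [cBa | notcBa] := boolP (a \in 'C(B1)).
    by rewrite mul1n (setIidPl _) // sub_cent1.
  rewrite !mul0n muln0 addn0.
  have aBP : {in B1, forall b, [~ a, b] \in P}.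
    by move=> b Bb; rewrite (subsetP sABP1) ?mem_commg.
  pose S := Group (commutator_image_group abP cPB1 aBP).
  have sSP : S \subset P by apply/subsetP=> _ /imsetP[b Bb ->]; apply: (aBP b).
  have oS : #|S| = #|B1 : 'C_B1[a]| by exact: card_commutator_image.
  have S_neq1 : #|S| != 1%N.
    apply: contra notcBa => /eqP/card1_trivg S1; apply/centP => b Bb.
    by apply/commgP; rewrite -in_set1 -[[set 1]]S1 imset_f.
  have /(prime_nt_dvdP p_pr S_neq1) <- := cardSg sSP.
  by rewrite oS mulnC Lagrange ?subsetIl.
have sBAP : [~: B, A] \subset P by rewrite commGC.
have NC : N A B = N B A.
  have NE (A1 B1 : {group gT}) :
      N A1 B1 = (\sum_(a in A1) \sum_(b in B1) (b \in 'C[a]))%N.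
    apply: eq_bigr => a _.
    by rewrite -sum1_card (eq_bigl _ _ (fun x => in_setI x _ _)) big_mkcondr.
  rewrite !NE exchange_big; apply: eq_bigr => b _; apply: eq_bigr => a _ /=.
  by rewrite cent1C.
have := count _ _ cPB sABP; have := count _ _ cPA sBAP; rewrite NC.
have := prime_gt1 p_pr; move: (N B A) => n; case: #|P| => // q.
rewrite ltnS => q_gt0.
rewrite !mulSn -!addnA ![(#|'C__(_)| * _ + _)%N]addnC !addnA => /addIn-> /addIn/eqP.
rewrite [(#|B| * #|A|)%N]mulnC eqn_add2r eqn_pmul2l // => /eqP.
by rewrite mulnC => ->; rewrite mulnC.
Qed.

(** * Classes, center and quotients of Camina groups *)

Lemma camina_class (gT : finGroupType) (G : {group gT}) g :
  camina_group G -> g \in G -> g \notin G^`(1) -> g ^: G = g *: G^`(1).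
Proof.
case/and4P=> _ _ _ /forall_inP clG Gg notG'g; apply/eqP.
rewrite eqEsubset clG ?inE ?notG'g // andbT; apply/subsetP => _ /imsetP[x Gx ->].
by rewrite mem_lcoset -commgEl mem_commg.
Qed.

Lemma camina_commutator (gT : finGroupType) (G : {group gT}) g z :
  camina_group G -> g \in G -> g \notin G^`(1) -> z \in G^`(1) ->
  exists2 x, x \in G & z = [~ g, x].
Proof.
move=> camG Gg notG'g G'z; have : g * z \in g ^: G.
  by rewrite camina_class // mem_lcoset mulKg.
by case/imsetP => x Gx Dx; exists x; rewrite // commgEl -Dx mulKg.
Qed.

(** For a central z outside G', all of G' would consist of commutators [z, x] = 1. *)
Lemma camina_center_sub (gT : finGroupType) (G : {group gT}) :
  camina_group G -> 'Z(G) \subset G^`(1).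
Proof.
move=> camG; apply/subsetP => z /centerP[Gz cGz]; apply: contraT => notG'z.
case/and4P: (camG); rewrite properE sub1G => /subsetPn[y G'y /set1P[]].
have [x Gx ->] := camina_commutator camG Gz notG'z G'y.
by apply/eqP/commgP/cGz.
Qed.

Lemma camina_quotient (gT : finGroupType) (G N : {group gT}) :
  N <| G -> N \proper G^`(1) -> camina_group G -> camina_group (G / N).
Proof.
move=> nsNG ltNG' camG; have nNG := normal_norm nsNG.
have sNG' := proper_sub ltNG'; have nG'N := subset_trans (der_sub 1 G) nNG.
have nsNG' : N <| G^`(1) by rewrite /normal sNG'.
have G'N : (G / N)^`(1) = G^`(1) / N by rewrite quotient_der.
case/and4P: (camG) => _ ltG'G _ _; rewrite /camina_group /camina_pair.
apply/and4P; split; last 2 first.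
- exact: der_normal.
- apply/forall_inP => gN; rewrite inE => /andP[notG'g /morphimP[g nNg Gg /= Dg]].
  rewrite {gN}Dg in notG'g *; rewrite G'N in notG'g *.
  have notGg : g \notin G^`(1) by apply: contra notG'g; apply: mem_quotient.
  rewrite -quotient_class // camina_class // quotientMl ?sub1set //.
  by rewrite quotient_set1.
- by rewrite G'N proper1G -subG1 quotient_sub1 // proper_subn.
- by rewrite G'N quotient_proper.
Qed.

(** G' and G / G' are vector spaces over F_p, and the commutator is an alternating bilinear map on G
    / G' with values in G'. The Camina condition is the surjectivity required by
    [alternating_map_bound]. *)
Lemma camina_class2_bound (gT : finGroupType) (G : {group gT}) p :
  prime p -> p.-group G -> camina_group G -> G^`(1) \subset 'Z(G) ->
  (#|G^`(1)| ^ 2 <= #|G : G^`(1)|)%N.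
Proof.
move=> p_pr pG camG; set W := G^`(1)%G => sWZ.
have [ntW ltWG _ _] := and4P camG; rewrite proper1G in ntW.
have [sWG [x0 Gx0 notWx0]] := properP ltWG.
have nsWG : W <| G := der_normal 1 G; have nWG := normal_norm nsWG.
have pW := pgroupS sWG pG.
have cWG w y : w \in W -> y \in G -> commute w y.
  by move=> Ww Gy; case/centerP: (subsetP sWZ w Ww) => _; apply.
have memW x y : x \in G -> y \in G -> [~ x, y] \in W by apply: mem_commg.
have commX x y n : x \in G -> y \in G -> [~ x ^+ n, y] = [~ x, y] ^+ n.
  by move=> Gx Gy; apply: commXg; apply/commute_sym/cWG => //; apply: memW.
have Xp x : x \in G -> x ^+ p \in W.
  (* If x^p were outside G', every element of G' would be some [x^p, y] = [x, y]^p and so lie in the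
     Frattini subgroup, which is proper. *)
  move=> Gx; apply: contraR (proper_subn (Phi_proper ntW)) => notWxp.
  apply/subsetP => z Wz.
  have [y Gy ->] := camina_commutator camG (groupX p Gx) notWxp Wz.
  rewrite commX // (Phi_joing pW) mem_gen // inE.
  have Wxy := memW x y Gx Gy.
  by rewrite -[p]expn1 Mho_p_elt ?orbT // (mem_p_elt pW).
have abelW : p.-abelem W.
  apply/abelemP=> //; split=> [|z Wz].
    by apply/centsP => w Ww z Wz; apply: cWG; rewrite ?(subsetP sWG).
  (* For z = [x0, y], z^p = [x0^p, y] = 1, since x0^p lies in the central subgroup [W]. *)
  have [y Gy ->] := camina_commutator camG Gx0 notWx0 Wz.
  by rewrite -commX //; apply/eqP/commgP/cWG; rewrite ?Xp.
have abelE : p.-abelem (G / W).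
  apply/abelemP=> //; split=> [|_ /morphimP[x nWx Gx ->]]; first exact: der_abelian.
  by rewrite -morphX //= coset_id ?Xp.
have ntE : G / W != 1 by rewrite -subG1 quotient_sub1 // proper_subn.
(* [rep] is additive only modulo [W]; by [bW] this does not affect commutators. *)
pose rep u := repr (rVabelem abelE ntE u).
have coset_rep u : coset W (rep u) = rVabelem abelE ntE u by exact: coset_reprK.
have Grep u : rep u \in G.
  have : rep u \in coset W @*^-1 (G / W).
    by rewrite mem_morphpre ?repr_coset_norm //= coset_rep mem_rVabelem.
  by rewrite quotientGK.
pose b x y := abelem_rV abelW ntW [~ x, y].
have bMl x1 x2 y : x1 \in G -> x2 \in G -> y \in G ->
    b (x1 * x2) y = (b x1 y + b x2 y)%R.
  move=> Gx1 Gx2 Gy; have W12 := (memW _ _ Gx1 Gy, memW _ _ Gx2 Gy).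
  rewrite /b commMgJ abelem_rV_M ?memJ_norm ?W12 ?(subsetP nWG) //.
  by have /commgP/conjg_fixP-> : commute [~ x1, y] x2 by apply: cWG; rewrite ?W12.
have bV x y : x \in G -> y \in G -> b x y = (- b y x)%R.
  by move=> Gx Gy; rewrite /b -invg_comm abelem_rV_V ?memW.
have bW x1 x2 y : x1 \in G -> x2 \in G -> y \in G ->
    coset W x1 = coset W x2 -> b x1 y = b x2 y.
  move=> Gx1 Gx2 Gy eqW; have : x1 \in W :* x2.
    by apply/rcoset_kercosetP; rewrite ?(subsetP nWG).
  case/rcosetP=> w Ww ->; rewrite bMl ?(subsetP sWG w) //.
  by rewrite {1}/b; have /commgP/eqP-> := cWG _ _ Ww Gy; rewrite abelem_rV_1 add0r.
have repD u v : coset W (rep (u + v)%R) = coset W (rep u * rep v).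
  by rewrite [RHS]morphM ?(subsetP nWG) //= !coset_rep rVabelemD.
pose B u v := b (rep u) (rep v).
have BDl v : {morph B^~ v : u u' / (u + u')%R}.
  by move=> u u'; rewrite /B -bMl //; rewrite (bW _ (rep u * rep u')) ?groupM ?repD.
have BC u v : B u v = (- B v u)%R by apply: bV.
have le_dim : ((logn p #|W|).*2 <= logn p #|G / W|)%N.
  rewrite -(dim_abelemE abelW ntW) -(dim_abelemE abelE ntE).
  apply: (alternating_map_bound (B := B)) => //.
  - by move=> u v v'; rewrite BC BDl opprD -!(BC u).
  - by move=> u; rewrite /B /b commgg abelem_rV_1.
  move=> u z u0; have notWu : rep u \notin W.
    apply: contra u0 => Wu; apply/eqP/(@rVabelem_inj _ _ _ abelE ntE).
    by rewrite rVabelem0 -coset_rep coset_id.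
  have [y Gy Dy] := camina_commutator camG (Grep u) notWu (mem_rVabelem abelW ntW z).
  exists (abelem_rV abelE ntE (coset W y)).
  have Ey : coset W y \in G / W by rewrite mem_quotient.
  transitivity (b (rep u) y); last by rewrite /b -Dy rVabelemK.
  rewrite /B ![b (rep u) _]bV //; congr (- _)%R.
  by apply: bW; rewrite // coset_rep abelem_rV_K.
rewrite -card_quotient // (card_pgroup pW) (card_pgroup (quotient_pgroup W pG)).
by rewrite -expnM muln2 leq_pexp2l ?prime_gt0.
Qed.

(** * Camina groups of class 3 *)

Lemma camina_center_prime (gT : finGroupType) (G : {group gT}) p :
  prime p -> p.-group G -> camina_group G -> prime #|[~: G^`(1), G]| ->
  [~: G^`(1), G] \subset 'Z(G) -> 'Z(G) = [~: G^`(1), G].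
Proof.
move=> p_pr pG camG prL sLZ; set W := G^`(1)%G; set L := [~: W, G]%G.
have sWG : W \subset G := der_sub 1 G; have pW := pgroupS sWG pG.
have sZW : 'Z(G) \subset W := camina_center_sub camG.
have sLW : L \subset W := subset_trans sLZ sZW.
have cLG : L \subset 'C(G) by apply: subset_trans sLZ (subsetIr _ _).
have LG1 : [~: L, G] = 1%g by apply/commG1P.
(* W = [G, G], and both [G, W, G] and [W, G, G] equal [L, G] = 1. *)
have cWW : abelian W.
  rewrite abelianE; apply/commG1P; apply: three_subgroup; last exact: LG1.
  by rewrite [[~: G, W]]commGC.
pose C := 'C_G(W)%G; have sCG : C \subset G by apply: subsetIl.
have sWC : W \subset C by rewrite subsetI sWG.
have cWC : [~: W, C] = 1 by apply/commG1P; rewrite centsC subsetIr.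
have sCCZ : [~: C, C] \subset 'Z(G).
  rewrite subsetI (subset_trans (commgSS sCG sCG) (der_sub 1 G)) /=.
  apply/commG1P; apply: three_subgroup; apply/trivgP; rewrite -cWC.
    by rewrite commSg ?(commSg G sCG).
  by rewrite commSg // commGC (commSg G sCG).
have oWC : (#|W| * #|C| = #|G| * #|'Z(G)|)%N.
  have -> : 'Z(G) = 'C_W(G).
    by apply/eqP; rewrite eqEsubset subsetI sZW subsetIr setSI.
  apply: (@card_cent_commutator_prime _ W G L) => //.
  exact: subset_trans cLG (centS sWG).
have ntL : L :!=: 1 by apply: contraL prL => /eqP->; rewrite cards1.
have ltZW : 'Z(G) \proper W.
  rewrite properE sZW; apply: contra ntL => sWZ.
  by apply/eqP/commG1P; apply: subset_trans sWZ (subsetIr _ _).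
have [M maxM sZM] : exists2 M : {group gT}, maximal M W & 'Z(G) \subset M.
  case: (maximal_exists sZW) => [eqZ | [M maxM sZM]]; last by exists M.
  by rewrite eqZ properxx in ltZW.
have iM : #|W : M| = p by apply: p_maximal_index pW maxM.
have ltMW := maxgroupp maxM; have sMW := proper_sub ltMW.
have nsMG : M <| G.
  rewrite /normal (subset_trans sMW) //= -commg_subl.
  by rewrite (subset_trans (commSg _ sMW)) // (subset_trans sLZ).
have nMG := normal_norm nsMG; have nMW := subset_trans sWG nMG.
have nMC := subset_trans sCG nMG.
have camGM := camina_quotient nsMG ltMW camG.
have WM : (G / M)^`(1) = W / M by rewrite quotient_der.
have oWM : #|W / M| = p by rewrite card_quotient.
have cWMG : W / M \subset 'C(G / M).
  by rewrite quotient_cents2r // (subset_trans sLZ).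
have le_CG : (#|C| ^ 2 <= #|G| * #|W|)%N.
  have oC := card_quotient nMC; have oG := card_quotient nMG.
  have sCMG : C / M \subset G / M := quotientS M sCG.
  (* The abelian group C/M lies in its centralizer in G/M, while its elements central in G/M lie in
     W/M, of order p; so the pairing gives |C/M|^2 <= |G/M| p. *)
  have := @card_cent_commutator_prime _ (C / M)%G (G / M)%G (W / M)%G.
  rewrite oWM => /(_ p_pr (subset_trans cWMG (centS sCMG)) cWMG).
  have sRW : [~: C / M, G / M] \subset W / M by rewrite -WM commSg.
  move/(_ sRW) => oCM.
  have : (#|C / M| * #|C / M| <= #|G / M| * p)%N.
    apply: (@leq_trans (#|C / M| * #|'C_(G / M)(C / M)|)).
      rewrite leq_mul2l subset_leq_card ?orbT // subsetI sCMG quotient_cents2r //.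
      exact: subset_trans sCCZ sZM.
    rewrite oCM leq_mul2l -oWM -WM subset_leq_card ?orbT //.
    by apply: subset_trans (camina_center_sub camGM); rewrite setSI.
  rewrite -(Lagrange (subset_trans sMW sWC)) -(Lagrange (normal_sub nsMG)).
  rewrite -(Lagrange sMW) iM -oC -oG expnMn mulnACA -mulnn leq_mul2l mulnn => ->.
  by rewrite orbT.
have ltLW : L \proper W.
  rewrite properE sLW; apply: contra ntL => sWL.
  by rewrite -subG1 -LG1 commSg.
have nsLG : L <| G by rewrite /normal (subset_trans sLW) // cents_norm // centsC.
have le_W : (#|W| ^ 3 <= #|G| * #|L| ^ 2)%N.
  have WL : (G / L)^`(1) = W / L by rewrite quotient_der ?normal_norm.
  have camGL := camina_quotient nsLG ltLW camG.
  have := camina_class2_bound p_pr (quotient_pgroup L pG) camGL.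
  have nLW : W \subset 'N(L) := subset_trans sWG (normal_norm nsLG).
  rewrite WL subsetI quotientS // quotient_cents2r // => /(_ isT).
  rewrite card_quotient // index_quotient_eq ?normal_norm //; last first.
    by rewrite subIset // sLW orbT.
  move=> le_WL; rewrite (expnS _ 2) -(Lagrange sWG) -mulnA leq_pmul2l //.
  by rewrite -(Lagrange sLW) expnMn mulnC leq_mul2r le_WL orbT.
have : (#|G| ^ 2 * #|'Z(G)| ^ 2 <= #|G| ^ 2 * #|L| ^ 2)%N.
  (* As |G| |Z| = |W| |C|, the left side is |W|^2 |C|^2 <= |W|^3 |G| <= |G|^2 |L|^2. *)
  rewrite -expnMn -oWC expnMn.
  apply: (@leq_trans (#|W| ^ 3 * #|G|)).
    by rewrite (expnSr _ 2) -mulnA leq_mul2l [(#|W| * _)%N]mulnC le_CG orbT.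
  by rewrite mulnC -[in leqRHS]mulnn -mulnA leq_mul2l le_W orbT.
rewrite leq_pmul2l ?expn_gt0 ?cardG_gt0 // leq_sqr => le_ZL.
by apply/esym/eqP; rewrite eqEcard sLZ.
Qed.

Lemma camina_class3_class (gT : finGroupType) (G : {group gT}) p y :
  prime p -> p.-group G -> camina_group G -> [~: G^`(1), G] \subset 'Z(G) ->
  y \in G^`(1) -> y \notin [~: G^`(1), G] -> y ^: G = y *: [~: G^`(1), G].
Proof.
move=> p_pr pG camG; set W := G^`(1)%G; set L := [~: W, G]%G => sLZ Wy notLy.
have sWG : W \subset G := der_sub 1 G.
have sZW : 'Z(G) \subset W := camina_center_sub camG.
have sLW : L \subset W := subset_trans sLZ sZW.
have cGL : L \subset 'C(G) by apply: subset_trans sLZ (subsetIr _ _).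
have cLL : abelian L.
  by rewrite /abelian (subset_trans cGL) ?centS ?(subset_trans sLW).
have memL x : x \in G -> [~ y, x] \in L by move=> Gx; apply: mem_commg.
pose S := Group (commutator_image_group cLL cGL memL).
have sSL : S \subset L by apply/subsetP => _ /imsetP[x Gx ->]; apply: (memL x).
have [eqSL | [N maxN sSN]] := maximal_exists sSL; last first.
  have ltNL := maxgroupp maxN; have sNL := proper_sub ltNL.
  have pL : p.-group L := pgroupS (subset_trans sLW sWG) pG.
  have nsNG : N <| G.
    rewrite /normal (subset_trans sNL) ?(subset_trans sLW) //=.
    by rewrite cents_norm // centsC (subset_trans sNL).
  have nNG := normal_norm nsNG; have nNW := subset_trans sWG nNG.
  have camGN := camina_quotient nsNG (proper_sub_trans ltNL sLW) camG.
  have WN : (G / N)^`(1) = W / N by rewrite quotient_der.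
  have LN : [~: (G / N)^`(1), G / N] = L / N by rewrite WN -quotientR.
  have nNL := subset_trans sLW nNW.
  have oLN : #|L / N| = p by rewrite card_quotient ?(p_maximal_index pL maxN).
  have ZGN : 'Z(G / N) = L / N.
    rewrite -LN; apply: (camina_center_prime p_pr (quotient_pgroup N pG) camGN).
      by rewrite LN oLN.
    by rewrite LN subsetI quotientS ?(subset_trans sLW) // quotient_cents.
  (* Since [y, G] lies in [N], y is central modulo [N], hence lies in L N = L. *)
  case/negP: notLy; have nNy := subsetP nNW y Wy.
  have : coset N y \in 'Z(G / N).
    apply/centerP; split; first by rewrite mem_quotient ?(subsetP sWG).
    move=> _ /morphimP[x nNx Gx ->]; apply/commgP.
    by rewrite -morphR //= coset_id // (subsetP sSN) // imset_f.
  rewrite ZGN => /morphimP[z nNz Lz /(kercoset_rcoset nNy nNz)[n Nn ->]].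
  by rewrite groupM // (subsetP sNL).
apply/eqP; rewrite -eqSL eqEsubset; apply/andP; split; apply/subsetP => z.
  by case/imsetP=> x Gx ->; rewrite mem_lcoset -commgEl imset_f.
rewrite mem_lcoset => /imsetP[x Gx]; rewrite commgEl => /mulgI->.
exact: memJ_class.
Qed.

(** A central y outside L = [G', G] would have class {y} = y L, forcing L = 1. *)
Lemma camina_class3_center (gT : finGroupType) (G : {group gT}) p :
  prime p -> p.-group G -> camina_group G -> nil_class G = 3 ->
  'Z(G) = [~: G^`(1), G].
Proof.
move=> p_pr pG camG clG; have nilG := pgroup_nil pG.
have L3E : 'L_3(G) = [~: G^`(1), G] by rewrite lcnSn lcn2.
have sLZ : [~: G^`(1), G] \subset 'Z(G).
  rewrite -L3E subsetI lcn_sub; apply/commG1P; rewrite -lcnSn.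
  by apply/(lcn_nil_classP 3 nilG); rewrite clG.
have ntL : [~: G^`(1), G] != 1.
  rewrite -L3E; apply/eqP => L1.
  by have := introT (lcn_nil_classP 2 nilG) L1; rewrite clG.
apply/eqP; rewrite eqEsubset sLZ andbT; apply/subsetP => y Zy.
apply: contraT => notLy; case/eqP: ntL; apply: card1_trivg.
rewrite -(card_lcoset _ y) -(camina_class3_class p_pr) //.
  by case/setIP: Zy => _ cGy; rewrite -index_cent1 (setIidPl _) ?indexgg ?sub_cent1.
exact: subsetP (camina_center_sub camG) y Zy.
Qed.

Local Open Scope ring_scope.

(** * Character sums *)

(** The sum is the regular character of G / N at the image of g, inflation being a bijection onto
    the characters with [N] in the kernel. *)
Lemma sum_irr_quo (gT : finGroupType) (G N : {group gT}) g :
  N <| G -> g \in G ->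
  \sum_(i | N \subset cfker 'chi[G]_i) 'chi_i 1%g * 'chi_i g
    = (g \in N)%:R * #|G : N|%:R.
Proof.
move=> nsNG Gg; have nNg := subsetP (normal_norm nsNG) g Gg.
have := congr1 (fun phi : 'CF(G / N) => phi (coset N g)) (cfReg_sum (G / N)%G).
rewrite cfRegE sum_cfunE card_quotient ?normal_norm // => sumE.
transitivity (#|G : N|%:R *+ (coset N g == 1%g) : algC); last first.
  rewrite mulr_natl; congr (_ *+ nat_of_bool _).
  by apply/eqP/idP => [/(coset_idr nNg) | /coset_id].
rewrite sumE (reindex _ (mod_Iirr_bij nsNG)) /=.
apply: eq_big => [j | j _]; first by rewrite mod_IirrE // cfker_mod.
by rewrite mod_IirrE // cfMod1 cfModE // cfunE.
Qed.

(** Each z in [N] acts as a scalar a, and gz is conjugate to g, so a chi(g) = chi(g); if chi(g) is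
    nonzero, a = 1 for every z. *)
Lemma central_camina_char_vanish (gT : finGroupType) (G N : {group gT}) i g :
  N \subset 'Z(G) -> g \in G -> (g *: N \subset g ^: G)%g ->
  ~~ (N \subset cfker 'chi[G]_i) -> 'chi_i g = 0.
Proof.
move=> sNZ Gg clg; apply: contraNeq => nz; apply/subsetP => z Nz.
have [Gz _] := setIP (subsetP sNZ z Nz).
have /is_scalar_mxP[a Da] : is_scalar_mx ('Chi_i z).
  have : z \in 'Z('chi_i)%CF.
    by have := subsetP sNZ z Nz; rewrite -cap_cfcenter_irr => /bigcapP; apply.
  by rewrite -irrRepr cfcenter_repr => /setIdP[].
have chiMz h : h \in G -> 'chi_i (h * z)%g = a * 'chi_i h.
  move=> Gh; rewrite -irrRepr !cfunE groupM // Gh !mulr1n repr_mxM // Da.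
  by rewrite scalar_mxC mul_scalar_mx linearZ.
rewrite cfkerEirr inE -[z]mul1g chiMz //.
have /imsetP[x Gx Dx] : (g * z)%g \in g ^: G.
  by rewrite (subsetP clg) // mem_lcoset mulKg.
have := chiMz g Gg; rewrite Dx cfunJ // -{1}['chi_i g]mul1r => /(mulIf nz) <-.
by rewrite mul1r.
Qed.

(** These chi vanish off [N] and have constant modulus chi(1) on it, so norm 1 gives chi(1)^2 = |G :
    N|. Hence 1 / chi(1) is chi(1) / |G : N|, and the sum is a multiple of the regular character of
    G minus that of G / N. *)
Lemma sum_irr_over (gT : finGroupType) (G N : {group gT}) g :
  N \subset 'Z(G) -> {in G, forall x, x \notin N -> (x *: N \subset x ^: G)%g} ->
  g \in G ->
  \sum_(i | ~~ (N \subset cfker 'chi[G]_i)) ('chi_i 1%g)^-1 * 'chi_i g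
    = (g \in N)%:R * (#|N|%:R * (g == 1%g)%:R - 1).
Proof.
move=> sNZ clN Gg; have sNG := subset_trans sNZ (center_sub G).
have nsNG : N <| G by rewrite sub_center_normal.
have chi0 i x : ~~ (N \subset cfker 'chi[G]_i) -> x \notin N -> 'chi_i x = 0.
  have [Gx | notGx _ _] := boolP (x \in G); last exact: cfun0.
  move=> kerN notNx.
  exact: central_camina_char_vanish sNZ Gx (clN x Gx notNx) kerN.
have [Ng | notNg] := boolP (g \in N); last first.
  by rewrite mul0r big1 // => i kerN; rewrite (chi0 i g) ?mulr0.
have iNG : #|G : N|%:R != 0 :> algC by apply: neq0CiG.
have chi1 i : ~~ (N \subset cfker 'chi[G]_i) ->
    ('chi_i 1%g)^-1 = #|G : N|%:R^-1 * 'chi_i 1%g.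
  move=> kerN; have chiN : 'chi_i \in 'CF(G, N) by apply/cfun_onP => x; apply: chi0.
  have := cfnorm_irr i; rewrite (cfnormE chiN).
  rewrite (eq_bigr (fun=> 'chi_i 1%g ^+ 2)) => [|x Nx]; last first.
    congr (_ ^+ 2); apply/eqP; rewrite -irr_cfcenterE ?(subsetP sNG) //.
    by have := subsetP sNZ x Nx; rewrite -cap_cfcenter_irr => /bigcapP; apply.
  rewrite sumr_const -[_ ^+ 2 *+ _]mulr_natl => /(congr1 ( *%R #|G|%:R)).
  rewrite mulVKf ?neq0CG // mulr1 -(Lagrange sNG) natrM => /(mulfI (neq0CG N)) chi2.
  apply: (mulfI (irr1_neq0 i)); rewrite mulfV ?irr1_neq0 // mulrCA -expr2 chi2.
  by rewrite mulVf.
rewrite mul1r.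
rewrite (eq_bigr (fun i => #|G : N|%:R^-1 * ('chi_i 1%g * 'chi_i g)))
  => [|i kerN]; last first.
  by rewrite chi1 // mulrA.
rewrite -mulr_sumr; apply: (canLR (mulKf iNG)).
have := congr1 (fun phi : 'CF(G) => phi g) (cfReg_sum G).
rewrite cfRegE sum_cfunE.
rewrite (eq_bigr (fun i => 'chi_i 1%g * 'chi_i g)) => [|i _]; last by rewrite cfunE.
rewrite (bigID (fun i => N \subset cfker 'chi_i)) /= sum_irr_quo // Ng mul1r => sumE.
rewrite mulrBr mulr1 mulrA -natrM mulnC Lagrange // mulr_natr sumE.
by rewrite [RHS]addrC addKr.
Qed.

(** * Counting solutions *)

Lemma commutator_fiberE (gT : finGroupType) (G K : {group gT}) y g :
  y \in G -> (y ^: G = y *: K)%g ->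
  #|[set a in G | [~ y, a]%g == g]|%:R
    = (g \in K)%:R * (#|G|%:R / #|K|%:R) :> algC.
Proof.
move=> Gy /(card_commutator_fiber g Gy) fiberE; rewrite mulrA.
by apply: (canRL (mulfK (neq0CG K))); rewrite -!natrM fiberE.
Qed.

Lemma central_class (gT : finGroupType) (G : {group gT}) y :
  y \in 'Z(G)%g -> (y ^: G = y *: 1%G)%g.
Proof.
case/centerP=> Gy cyG; rewrite mulg1; apply/setP=> z; rewrite inE.
apply/imsetP/eqP => [[x Gx ->] | ->].
  by have /commgP/conjg_fixP := cyG x Gx.
by exists 1%g; rewrite ?conjg1.
Qed.

Lemma sum_commutators (gT : finGroupType) (G W : {group gT}) x (f : gT -> algC) :
  x \in G -> (x ^: G = x *: W)%g ->
  \sum_(a in G) f [~ x, a]%g = #|G|%:R / #|W|%:R * \sum_(z in W) f z.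
Proof.
move=> Gx clx; rewrite (partition_big (fun a => [~ x, a]%g) (mem W)) => [|a Ga].
  rewrite mulr_sumr; apply: eq_bigr => z /= Wz.
  rewrite (eq_bigr (fun=> f z)) => [|a /andP[_ /eqP-> //]].
  have := commutator_fiberE z Gx clx; rewrite Wz mul1r => <-.
  by rewrite sumr_const mulr_natl; congr (_ *+ _); apply: eq_card => a; rewrite !inE.
by have := memJ_class x Ga; rewrite clx mem_lcoset -commgEl.
Qed.

Lemma Iirr_overE (gT : finGroupType) (G N : {group gT}) i :
  N <| G -> (i \in Iirr_over G N) = ~~ (N \subset cfker 'chi_i).
Proof.
move=> nsNG; rewrite !inE andbT; congr (~~ _); apply/imsetP/idP => [[j _ ->] | kerN].
  by rewrite mod_IirrE // cfker_mod.
by exists (quo_Iirr N i); rewrite ?quo_IirrK.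
Qed.

(** Solutions are summed over (a, b), with [f y] counting the c such that [y, c] = g. For a in G',
    [a, b] is central and [f] is constant there; for a outside G', [a, b] is equidistributed on G',
    which splits into Z and its complement. *)
Lemma zeta_w3_camina (gT : finGroupType) (G : {group gT}) p g :
  prime p -> p.-group G -> camina_group G -> nil_class G = 3%N ->
  let oG : algC := #|G|%:R in
  let oG' : algC := #|G^`(1)%g|%:R in
  let oZ : algC := #|'Z(G)%g|%:R in
  (zeta_w3 G g)%:R
    = oG' * (oG ^+ 2 * (g == 1%g)%:R)
      + (oG - oG') * (oG / oG' * (oZ * (oG * (g == 1%g)%:R)
                       + (oG' - oZ) * (oG / oZ * (g \in 'Z(G)%g)%:R))).
Proof.
move=> p_pr pG camG clG; set W := G^`(1)%G; move=> oG oG' oZ.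
have ZE := camina_class3_center p_pr pG camG clG.
have sZW := camina_center_sub camG; have sWG : W \subset G := der_sub 1 G.
pose f y : algC := #|[set a in G | [~ y, a]%g == g]|%:R.
have fZ y : y \in 'Z(G)%g -> f y = oG * (g == 1%g)%:R.
  move=> Zy; have Gy := subsetP (center_sub G) y Zy.
  by rewrite /f (commutator_fiberE _ Gy (central_class Zy)) cards1 divr1 inE mulrC.
have fW y : y \in W :\: 'Z(G) -> f y = oG / oZ * (g \in 'Z(G)%g)%:R.
  case/setDP=> Wy notZy; have Gy := subsetP sWG y Wy.
  have clY : (y ^: G = y *: 'Z(G)%G)%g.
    by rewrite /= ZE; apply: (camina_class3_class p_pr pG camG); rewrite -?ZE.
  by rewrite /f (commutator_fiberE _ Gy clY) mulrC.
have -> : (zeta_w3 G g)%:R = \sum_(a in G) \sum_(b in G) f [~ a, b]%g.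
  rewrite /zeta_w3 -sum1_card natr_sum pair_big /=.
  under [RHS]eq_bigr => ab _ do rewrite /f -sum1_card natr_sum.
  rewrite pair_big_dep /=; apply: eq_bigl => -[[a b] c].
  by rewrite in_set /= in_set /= andbA.
have sumf : \sum_(z in W) f z = oZ * (oG * (g == 1%g)%:R)
                       + (oG' - oZ) * (oG / oZ * (g \in 'Z(G)%g)%:R).
  rewrite (big_setID 'Z(G)%g) (setIidPr sZW) /= (eq_bigr _ fZ) (eq_bigr _ fW).
  rewrite !sumr_const -![_ * _ *+ _]mulr_natl; congr (_ + _ * _).
  by rewrite cardsD (setIidPr sZW) natrB ?subset_leq_card.
rewrite (big_setID W) (setIidPr sWG) /=; congr (_ + _).
  rewrite (eq_bigr (fun=> oG ^+ 2 * (g == 1%g)%:R)) => [|a Wa]; last first.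
    rewrite (eq_bigr (fun=> oG * (g == 1%g)%:R)) => [|b Gb]; last first.
      by rewrite fZ // ZE mem_commg.
    by rewrite sumr_const -[_ * _ *+ _]mulr_natl mulrA.
  by rewrite sumr_const -[_ * _ *+ _]mulr_natl.
rewrite -sumf (eq_bigr (fun=> oG / oG' * \sum_(z in W) f z))
  => [|a /setDP[Ga notWa]].
  rewrite sumr_const -[_ * _ *+ _]mulr_natl cardsD (setIidPr sWG).
  by rewrite natrB ?subset_leq_card.
by apply: sum_commutators; rewrite ?camina_class.
Qed.

Theorem theorem3p7 (gT : finGroupType) (G : {group gT}) (p : nat)
    (p_pr : prime p) (pG : p.-group G) (caminaG : camina_group G)
    (classG : nil_class G = 3%N) (g : gT) (Gg : g \in G) :
  let oG : algC := #|G|%:R in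
  let oG' : algC := #|G^`(1)%g|%:R in
  let oZ : algC := #|'Z(G)%g|%:R in
  (zeta_w3 G g)%:R =
    (oG ^+ 2 *: (\sum_(i in lin_Iirr G) 'chi_i)
     + (oG ^+ 3 / oG' + oG ^+ 2 * (oG' - oZ) / oZ) *:
         (\sum_(i in Iirr_over G 'Z(G)%G) ('chi_i 1%g)^-1 *: 'chi_i)
     + (oG ^+ 3 / oG') *:
         (\sum_(j in nl_Iirr (G / 'Z(G))%G)
            let chi := ('chi_j %% 'Z(G))%CF in (chi 1%g)^-1 *: chi)
     : 'CF(G)) g.
Proof.
move=> oG oG' oZ; rewrite (zeta_w3_camina g p_pr pG caminaG classG) -/oG -/oG' -/oZ.
have ZE := camina_class3_center p_pr pG caminaG classG.
have sZW := camina_center_sub caminaG; have nsZG : 'Z(G) <| G := center_normal G.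
have nsWG : G^`(1)%g <| G := der_normal 1 G.
have nZG := normal_norm nsZG; have nZg := subsetP nZG g Gg.
have sWG := der_sub 1 G.
have ltZW : 'Z(G)%g \proper G^`(1)%g.
  rewrite properE sZW /=; apply/negP => sWZ.
  have nilG := pgroup_nil pG.
  suff : (nil_class G <= 2)%N by rewrite classG.
  by apply/(lcn_nil_classP 2 nilG); rewrite lcnSn lcn2; apply/commG1P;
    apply: subset_trans sWZ (subsetIr _ _).
have oG'0 : oG' != 0 := neq0CG _; have oZ0 : oZ != 0 := neq0CG _.
have linE : (\sum_(i in lin_Iirr G) 'chi_i) g = (g \in G^`(1)%g)%:R * (oG / oG').
  have iG : #|G : G^`(1)%g|%:R = oG / oG'.
    by apply: (canRL (mulfK oG'0)); rewrite -natrM mulnC Lagrange.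
  rewrite -iG -(sum_irr_quo nsWG Gg) sum_cfunE.
  apply: eq_big => [i | i]; rewrite inE ?lin_irr_der1 // => kerG'.
  by rewrite lin_char1 ?mul1r // lin_irr_der1.
have overE : (\sum_(i in Iirr_over G 'Z(G)%G) ('chi_i 1%g)^-1 *: 'chi_i) g
    = (g \in 'Z(G)%g)%:R * (oZ * (g == 1%g)%:R - 1).
  rewrite -(@sum_irr_over _ G 'Z(G)%G g) //; last first.
    move=> x Gx notZx; have [Wx | notWx] := boolP (x \in G^`(1)%g).
      by rewrite /= ZE (camina_class3_class p_pr pG caminaG) -?ZE.
    by rewrite camina_class // mulgS.
  rewrite sum_cfunE; apply: eq_big => [i | i _]; first by rewrite Iirr_overE.
  by rewrite cfunE.
have nlE : (\sum_(j in nl_Iirr (G / 'Z(G))%G)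
            let chi := ('chi_j %% 'Z(G))%CF in (chi 1%g)^-1 *: chi) g
    = (g \in G^`(1)%g)%:R * (oG' / oZ * (g \in 'Z(G)%g)%:R - 1).
  (* The nonlinear characters of G / Z are those nontrivial on its derived group [N], which is
     central because [G', G] = Z; so [sum_irr_over] applies again. *)
  pose N := (G^`(1) / 'Z(G))%G.
  have NE : ((G / 'Z(G))^`(1) = N)%g by rewrite /= quotient_der.
  have camGZ := camina_quotient nsZG ltZW caminaG.
  have nZW := subset_trans sWG nZG.
  have Ng : (coset 'Z(G) g \in N) = (g \in G^`(1)%g).
    apply/idP/idP => [Ng | ]; last exact: mem_quotient.
    have : g \in coset 'Z(G) @*^-1 N by rewrite mem_morphpre.
    by rewrite /= quotientGK // /normal sZW.
  have g1 : (coset 'Z(G) g == 1%g) = (g \in 'Z(G)%g).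
    by apply/eqP/idP => [/(coset_idr nZg) | /coset_id].
  have oN : #|N|%:R = oG' / oZ.
    rewrite card_quotient //; apply: (canRL (mulfK oZ0)).
    by rewrite -natrM mulnC Lagrange.
  rewrite -Ng -g1 -oN
    -(@sum_irr_over _ (G / 'Z(G))%G N (coset 'Z(G) g)) ?mem_quotient //.
  - rewrite sum_cfunE; apply: eq_big => [j | j _].
      by rewrite !inE lin_irr_der1 NE.
    by rewrite /= cfMod1 cfunE cfModE.
  - rewrite subsetI quotientS //= quotient_cents2r // -?ZE //.
  by move=> x Gx notNx; rewrite -NE camina_class // NE.
rewrite !cfunE linE overE nlE; clearbody oG oG' oZ => {linE overE nlE}.
(* On each of {1}, Z - {1}, G' - Z and G - G' a rational identity in the three orders remains. *)
have [Zg | notZg] := boolP (g \in 'Z(G)%g).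
  rewrite (subsetP sZW) //=.
  by case: (g == 1%g); rewrite ?mulr1n ?mulr0n; field; rewrite oG'0 oZ0.
have /negbTE-> : g != 1%g by apply: contraNneq notZg => ->; apply: group1.
by case: (g \in _); rewrite ?mulr1n ?mulr0n; field; rewrite oG'0 oZ0.
Qed.
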